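(* Let $S$ be a finite semigroup with principal series $S=S_1\supset S_2\supset\cdots\supset S_o\supset S_{o+1}=\emptyset$, and let $S_p/S_{p+1}$ be a non-null principal factor of $S$. The following properties hold. (1) If the principal factor $S_p/S_{p+1}$ is not CS-diagonal, then either $S_p\setminus S_{p+1}$ is contained in the $\eta^{*}$-class of $\theta$, or there is a principal factor $S_q/S_{q+1}$ with $q>p$ such that every element of $S_p\setminus S_{p+1}$ is $\eta^{*}$-related to some element of $S_q\setminus S_{q+1}$. (2) If there exists an element $a\in S_p\setminus S_{p+1}$ such that $a\,\eta^{*}\,\theta$, then $S_p\setminus S_{p+1}$ is contained in the $\eta^{*}$-class of $\theta$. (3) If every principal factor $S_q/S_{q+1}$ of $S$ with $q\ge p$ is null or is not CS-diagonal, then $S_p\setminus S_{p+1}$ is contained in the $\eta^{*}$-class of $\theta$.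
   Context: For a semigroup $S$, $S^1$ denotes $S$ if $S$ has an identity, and $S$ with an identity $1$ adjoined otherwise. For $x,y,z_1,z_2,\ldots$ in $S^1$ define recursively $\lambda_0=x$, $\rho_0=y$, and $\lambda_{n+1}=\lambda_n z_{n+1}\rho_n$, $\rho_{n+1}=\rho_n z_{n+1}\lambda_n$, where $\lambda_n=\lambda_n(x,y,z_1,\ldots,z_n)$ and $\rho_n=\rho_n(x,y,z_1,\ldots,z_n)$. For a semigroup $S$ let $\eta_1=\{(x,x)\mid x\in S\}$ and, for every integer $n>1$, let $x\,\eta_n\,y$ if and only if there exist $z_1,\ldots,z_n\in S^1$ such that $x=\lambda_n(x,y,z_1,\ldots,z_n)$ and $y=\rho_n(x,y,z_1,\ldots,z_n)$. Let $\eta$ be the transitive closure of $\bigcup_{i\ge 1}\eta_i$, and let $\eta^{*}$ be the smallest congruence on $S$ containing $\eta$. In the claim $\eta^*$ is taken on $S$. Principal series: each $S_p$ is an ideal of $S$ and there is no ideal of $S$ strictly between $S_p$ and $S_{p+1}$ (the empty set counts as an ideal, and $S_o/\emptyset=S_o$). Each principal factor $S_p/S_{p+1}$ is completely $0$-simple, completely simple, or null (all products equal zero; in particular a factor $\{\theta\}$ is null). The zero of $S$, if it exists, is denoted $\theta$; if $S$ has no zero, no element is $\eta^*$-related to $\theta$. Rees matrix semigroups: $G$ is a finite group, $P=(p_{ji})$ is an $m\times n$ matrix with entries in $G\cup\{\theta\}$. The nonzero elements of $\mathcal{M}^0(G,n,m;P)$ are the triples $(g;i,j)$ with $g\in G$,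 $1\le i\le n$, $1\le j\le m$; the zero is $\theta$; the product is $(g;i,j)(h;k,l)=(g p_{jk} h;i,l)$ if $p_{jk}\ne\theta$ and $\theta$ otherwise. It is regular if every row and every column of $P$ contains a nonzero entry. If all entries of $P$ are nonzero, the set $\mathcal{M}(G,n,m;P)$ of nonzero elements is itself a semigroup. Finite completely $0$-simple semigroups are exactly (up to isomorphism) the finite regular $\mathcal{M}^0(G,n,m;P)$, and finite completely simple ones are the $\mathcal{M}(G,n,m;P)$ with $P$ having no zero entries. A finite regular Rees matrix semigroup with sandwich matrix $P$ is CS-diagonal if for all $1\le r,r'\le m$, $1\le t,t'\le n$: whenever $p_{r,t},p_{r',t},p_{r,t'}$ are nonzero, $p_{r',t'}$ is nonzero. (So every completely simple factor is CS-diagonal.) A non-null principal factor is CS-diagonal if it is isomorphic to a CS-diagonal such semigroup. *)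

(* Defs.v *)
From Stdlib Require Import Relation_Definitions Relation_Operators.
From mathcomp Require Import all_boot all_fingroup all_algebra.

Set Implicit Arguments.
Unset Strict Implicit.
Unset Printing Implicit Defensive.

(* A semigroup is a type [S] with an associative operation
   [mul : SemiGroup.law S]. *)

Section Semigroup.
Variables (S : Type) (mul : SemiGroup.law S).
Local Notation "x * y" := (mul x y).
Implicit Types (x y e t : S) (u v : option S) (z : nat -> option S).

Definition is_identity e := forall x, e * x = x /\ x * e = x.

Definition is_zero t := forall x, t * x = t /\ x * t = t.

(* [S^1] lives inside [option S]: [Some x] is the element [x] of [S], and
   [None] is the identity adjoined only when [S] has none of its own. *)
Definition in_S1 u := u = None -> ~ exists e, is_identity e.

Definition mul1 u v :=
  match u, v with
  | Some x, Some y => Some (x * y)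
  | None, _ => v
  | _, None => u
  end.

(* The pair [(lambda_n, rho_n)]. *)
Fixpoint lambda_rho u v z n : option S * option S :=
  if n is k.+1 then
    let: (l, r) := lambda_rho u v z k in
    (mul1 (mul1 l (z k.+1)) r, mul1 (mul1 r (z k.+1)) l)
  else (u, v).

Definition lambda u v z n := (lambda_rho u v z n).1.
Definition rho u v z n := (lambda_rho u v z n).2.

(* [eta_ n] is only meaningful for [n >= 1]. *)
Definition eta_ n : relation S := fun x y =>
  if n == 1 then x = y
  else exists z,
    [/\ forall i, 1 <= i <= n -> in_S1 (z i),
        Some x = lambda (Some x) (Some y) z n
      & Some y = rho (Some x) (Some y) z n].

Definition eta : relation S :=
  clos_trans S (fun x y => exists2 n, 1 <= n & eta_ n x y).

Definition congruence (R : relation S) :=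
  equivalence S R /\
  forall x y t, R x y -> R (t * x) (t * y) /\ R (x * t) (y * t).

Definition eta_star : relation S := fun x y =>
  forall R : relation S, congruence R -> inclusion S eta R -> R x y.

(* Never holds when [S] has no zero. *)
Definition in_eta_star_class_of_zero x := exists2 t, is_zero t & eta_star x t.

End Semigroup.

Definition isomorphic (T U : finType) (C : {set T}) (mT : T -> T -> T)
    (D : {set U}) (mU : U -> U -> U) :=
  exists f : T -> U,
    [/\ {in C &, injective f},
        f @: C = D
      & {in C &, forall u v, f (mT u v) = mU (f u) (f v)}].

Section ReesMatrix.
Variables (gT : finGroupType) (n m : nat) (P : 'M[option gT]_(m, n)).

(* [Some (g, i, j)] is the triple [(g; i, j)] and [None] is the zero; likewise
   an entry of [P] is zero when it is [None]. *)
Definition rees : finType := option (gT * 'I_n * 'I_m).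

Definition rees_mul (u v : rees) : rees :=
  match u, v with
  | Some (g, i, j), Some (h, k, l) =>
      if P j k is Some q then Some ((g * q * h)%g, i, l) else None
  | _, _ => None
  end.

Definition regular_mx :=
  (forall j, exists i, P j i != None) /\ (forall i, exists j, P j i != None).

Definition no_zero_entry := forall j i, P j i != None.

Definition CS_diagonal_mx :=
  forall (r r' : 'I_m) (t t' : 'I_n),
    P r t != None -> P r' t != None -> P r t' != None -> P r' t' != None.

End ReesMatrix.

Section PrincipalFactors.
Variables (S : finType) (mul : SemiGroup.law S).
Local Notation "x * y" := (mul x y).
Implicit Types (A B : {set S}) (I : nat -> {set S}).

(* The empty set counts as an ideal. *)
Definition ideal A := forall x s, x \in A -> s * x \in A /\ x * s \in A.

Definition principal_series (o : nat) I :=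
  [/\ I 1 = [set: S],
      I o.+1 = set0
    & forall q, 1 <= q <= o ->
        [/\ ideal (I q),
            I q.+1 \proper I q
          & ~ exists J, [/\ ideal J, I q.+1 \proper J & J \proper I q]]].

(* The Rees quotient [A / B]: its elements are [Some x] for [x] in [A :\: B]
   together with, unless [B] is empty, the zero [None] standing for [B].
   In particular [A / set0] is [A]. *)
Definition factor A B : {set option S} :=
  [set u | if u is Some x then x \in A :\: B else B != set0].

Definition factor_mul B (u v : option S) : option S :=
  match u, v with
  | Some x, Some y => if x * y \in B then None else Some (x * y)
  | _, _ => None
  end.

Definition null_factor A B :=
  exists2 z, z \in factor A B &
    {in factor A B &, forall u v, factor_mul B u v = z}.

(* [[set~ None]] carries the zero-free semigroup [M(G, n, m; P)]. *)
Definition CS_diagonal_factor A B :=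
  exists (gT : finGroupType) (n m : nat) (P : 'M[option gT]_(m, n)),
    [/\ 0 < n, 0 < m, CS_diagonal_mx P
      & (regular_mx P /\
         isomorphic (factor A B) (factor_mul B)
                    [set: rees gT n m] (rees_mul P))
        \/
        (no_zero_entry P /\
         isomorphic (factor A B) (factor_mul B)
                    [set~ None : rees gT n m] (rees_mul P))].

End PrincipalFactors.

(* Main.v *)
(* Let J = I_p \ I_{p+1} be non-null. By finiteness J contains an idempotent e
   and is contained in S x S for each x in J, so Rees' theorem applies:
   with a_i, b_j representing the H-classes of the L-class and of the R-class of
   e, every element of J is uniquely a_i g b_j with g in the group H_e, and
   p_{ji} = b_j a_i.
   If P is not CS-diagonal at r, r', t, t', the idempotents with coordinates
   (t, r) and (t, r') form a right zero band, hence are eta_2-related; multiplied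
   on the right by an element of coordinates (t', r), one stays in J and the
   other falls into I_{p+1}. So some element of J is eta^*-related to an element
   of I_{p+1}, and since J is contained in every S x S, this spreads to all of J. *)
From HB Require Import structures.
Require Import Defs.
From mathcomp Require Import all_boot all_fingroup all_algebra.

Set Implicit Arguments.
Unset Strict Implicit.
Unset Printing Implicit Defensive.

(** * Groups inside a semigroup, duality, representatives *)

(** A left identity and left inverses already make a group. This turns the H-class of an idempotent
    into the structure group of the Rees matrix semigroup. *)
Lemma finGroup_of_set (S : finType) (mul : SemiGroup.law S) (e : S)
    (G : {set S}) :
    e \in G -> {in G &, forall x y, mul x y \in G} ->
    {in G, forall x, mul e x = x} ->
    {in G, forall x, exists2 y, y \in G & mul y x = e} ->
  exists (gT : finGroupType) (v : gT -> S),
    [/\ injective v, forall x, x \in G <-> exists g, x = v g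
      & {morph v : g h / (g * h)%g >-> mul g h}].
Proof.
move=> eG mulG mul1x invG.
pose T := {x : S | x \in G}.
pose m (x y : T) : T := Sub (mul (val x) (val y)) (mulG _ _ (valP x) (valP y)).
have [i iP] : exists i : T -> T, forall x, mul (val (i x)) (val x) = e.
  have /fin_all_exists : forall x : T, exists y : T, mul (val y) (val x) = e.
    by move=> x; have [y yG yx] := invG _ (valP x); exists (Sub y yG).
  by case=> i; exists i.
have mA : associative m by move=> x y z; apply: val_inj; exact: SemiGroup.opA.
pose one : T := Sub e eG.
have m1 : left_id one m by move=> x; apply: val_inj; exact: (mul1x _ (valP x)).
have mV : left_inverse one i m.
  by move=> x; apply: val_inj; exact: iP.
pose B := Finite_isGroup.Build T mA m1 mV.
pose gT : finGroupType := HB.pack T B.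
exists gT, (val : T -> S); split=> //; first exact: val_inj.
move=> x; split=> [xG | [g ->]]; last exact: (valP g).
by exists (exist _ x xG).
Qed.

(* Lets one-sided lemmas be dualised. *)
Definition flip_mul (S : Type) (mul : S -> S -> S) := fun x y => mul y x.

Lemma flip_mulA (S : Type) (mul : SemiGroup.law S) : associative (flip_mul mul).
Proof. by move=> x y z; rewrite /flip_mul SemiGroup.opA. Qed.

HB.instance Definition _ (S : Type) (mul : SemiGroup.law S) :=
  SemiGroup.isLaw.Build S (flip_mul mul) (@flip_mulA S mul).

(** On [L] the function [rep] never falls back on its default and depends on [k x] alone, so its
    image meets each fibre once. *)
Lemma rep_set (T : finType) (U : eqType) (k : T -> U) (L : {set T}) :
  exists A : {set T},
    [/\ A \subset L, {in L, forall x, exists2 y, y \in A & k y = k x}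
      & {in A &, injective k}].
Proof.
pose rep x := odflt x [pick y in L | k y == k x].
have repP x : x \in L -> rep x \in L /\ k (rep x) = k x.
  move=> xL; rewrite /rep; case: pickP => [y /andP[yL /eqP] | _] //=.
exists (rep @: L); split.
- by apply/subsetP=> _ /imsetP[x /repP[] ? _ ->].
- by move=> x xL; exists (rep x); [exact: imset_f | case: (repP x xL)].
move=> _ _ /imsetP[x xL ->] /imsetP[y yL ->].
have [_ ->] := repP x xL; have [_ ->] := repP y yL => kxy; rewrite /rep.
have -> : [pick z in L | k z == k x] = [pick z in L | k z == k y].
  by apply: eq_pick => z; rewrite kxy.
by case: pickP => //= /(_ y); rewrite yL eqxx.
Qed.

(* For a principal factor [A / K] this is equivalent to not being null. *)
Definition regular_factor (S : finType) (mul : SemiGroup.law S)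
    (A K : {set S}) :=
  [/\ ideal mul A, ideal mul K
    & {in A :\: K &, forall x y, exists s t, y = mul (mul s x) t}].

Lemma regular_factor_flip (S : finType) (mul : SemiGroup.law S)
    (A K : {set S}) :
  regular_factor mul A K -> regular_factor (flip_mul mul) A K.
Proof.
case=> iA iK sim; split=> [x s xA|x s xK|x y xJ yJ].
- by have [] := iA x s xA.
- by have [] := iK x s xK.
have [s [t ->]] := sim _ _ xJ yJ; exists t, s.
by rewrite /= /flip_mul SemiGroup.opA.
Qed.

(** * Idempotent powers in a finite semigroup *)

Section Semigroup.
Variables (S : finType) (mul : SemiGroup.law S).
Local Notation "x * y" := (mul x y).
Let mulA := @SemiGroup.opA S mul.

Lemma idempotent_multiple (y : S) :
  exists u k, let f := y * u in f * f = f /\ f = iter k (mul y) y.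
Proof.
(* [p k] is the power of [y] with exponent [k.+1], whence the successor in [pD]. *)
pose p k := iter k (mul y) y.
have pD i j : p i * p j = p (i + j).+1.
  by elim: i => //= i IH; rewrite -mulA IH.
have [i [d pid]] : exists i d, p i = p (i + d.+1)%N.
  have := loopingP (looping_order (mul y) y) (fingraph.order (mul y) y).
  case/trajectP=> i ltio pio; exists i, (fingraph.order (mul y) y - i.+1)%N.
  by rewrite addnS -addSn subnKC.
have shift j : p (i + j) = p (i + j + d.+1)%N.
  elim: j => [|j IH]; first by rewrite !addn0.
  by rewrite addnS addSn /p !iterS -/(p _) -/(p _) IH.
have shifts k j : p (i + j) = p (i + j + k * d.+1)%N.
  elim: k => [|k IH]; first by rewrite addn0.
  by rewrite IH -addnA shift -!addnA mulSnr.
(* y^(d(i+2)) is idempotent, d being a period of the powers of y. *)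
pose k := (i.+2 * d.+1).-2.
have k2 : k.+2 = (i.+2 * d.+1)%N by rewrite /k !mulSn /= !addSn addnS.
exists (p k), k.+1; split=> //; rewrite -[y * _]/(p k.+1) pD.
have lik : (i <= k.+1)%N.
  by rewrite -ltnS k2; apply: leq_trans (leq_pmulr _ _).
by rewrite -addnS k2 -(subnKC lik) -shifts.
Qed.

(** Iterating the equation gives [a = s' * a * y^n] for every n >= 1; once y^n is idempotent, [a]
    absorbs it. *)
Lemma fixed_absorb (a s y : S) :
  a = s * a * y -> exists u, (y * u) * (y * u) = y * u /\ a * (y * u) = a.
Proof.
move=> asy; have [u [k [ff fk]]] := idempotent_multiple y.
exists u; split=> //.
have powers n : exists s', a = s' * a * iter n (mul y) y.
  elim: n => [|n [s' IH]]; first by exists s.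
  by exists (s' * s); rewrite /= {1}IH {1}asy !mulA.
have [s' as'] := powers k.
by rewrite -fk in as'; rewrite {1}as' -mulA ff -as'.
Qed.
End Semigroup.

(** * Green's relations in a regular factor *)

Section RegularFactor.
Variables (S : finType) (mul : SemiGroup.law S) (A K : {set S}).
Hypothesis RF : regular_factor mul A K.
Local Notation "x * y" := (mul x y).
Local Notation J := (A :\: K).
Let mulA := @SemiGroup.opA S mul.
Let iA : ideal mul A. Proof. by case: RF. Qed.
Let iK : ideal mul K. Proof. by case: RF. Qed.

(** Stability of finite semigroups: from [a = s * a * (x * t)], [a] absorbs an idempotent right
    multiple of [x * t]. *)
Lemma right_stable (a x : S) : a \in J -> a * x \in J -> exists u, a = a * x * u.
Proof.
case: RF => _ _ sim aJ axJ; have [s [t asx]] := sim _ _ axJ aJ.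
have [|u [_ au]] := @fixed_absorb _ mul a s (x * t).
  by rewrite !mulA in asx *.
by exists (t * u); rewrite -{1}au !mulA.
Qed.

Lemma regular_factor_idempotent (a b : S) :
  a \in J -> b \in J -> a * b \in J -> exists2 e, e \in J & e * e = e.
Proof.
case: RF => _ _ sim aJ bJ abJ; have [s [t asx]] := sim _ _ abJ aJ.
have [|u [ff af]] := @fixed_absorb _ mul a s (b * t).
  by rewrite !mulA in asx *.
(* This idempotent fixes [a] on the right, so it cannot lie in [K] unless [a] does. *)
exists (b * t * u) => //; move: aJ bJ; rewrite !inE => /andP[aK aA] /andP[bK bA].
apply/andP; split; last by rewrite -mulA; case: (iA (t * u) bA).
by apply: contra aK => fK; rewrite -af; case: (iK a fK).
Qed.

Variable e : S.

(** For an idempotent [e] in [J], stability makes this equation describe Green's L-class of [e]. *)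
Definition L_class := [set a in J | a * e == a].

Definition H_class := [set a in L_class | e * a == a].

Hypotheses (eJ : e \in J) (ee : e * e = e).

Let eA : e \in A. Proof. by move: eJ; rewrite inE => /andP[]. Qed.
Let eK : e \notin K. Proof. by move: eJ; rewrite inE => /andP[]. Qed.

Lemma L_classP (a : S) : reflect [/\ a \in A, a \notin K & a * e = a] (a \in L_class).
Proof.
rewrite !inE -andbA; apply: (iffP and3P).
  by case=> ? ? /eqP.
by case=> ? ? ->.
Qed.

Lemma H_classP (a : S) :
  reflect [/\ a \in A, a \notin K, a * e = a & e * a = a] (a \in H_class).
Proof.
rewrite inE; apply: (iffP andP) => [[/L_classP[? ? ?] /eqP] | [? ? ? ->]] //.
by split=> //; apply/L_classP.
Qed.

Lemma mem_H_class (x : S) : e * x * e \notin K -> e * x * e \in H_class.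
Proof.
move=> xK; apply/H_classP; rewrite -!mulA ee !mulA ee; split=> //.
by case: (iA (e * x) eA).
Qed.

Lemma mem_L_class (x : S) : x * e \notin K -> x * e \in L_class.
Proof.
by move=> xK; apply/L_classP; rewrite -mulA ee; split=> //; case: (iA x eA).
Qed.

Lemma right_inverse (b : S) :
  b \in J -> e * b = b -> exists2 u, u \in L_class & b * u = e.
Proof.
move=> bJ eb; have [|u ebu] := @right_stable e b eJ; first by rewrite eb.
rewrite eb in ebu; have bue : b * (u * e) = e by rewrite mulA -ebu.
exists (u * e) => //; apply: mem_L_class.
by apply: contra eK => ueK; rewrite -bue; case: (iK b ueK).
Qed.

(** The last clause says that distinct representatives generate right ideals meeting only inside
    [K]; it yields the uniqueness of coordinates. *)
Lemma L_class_transversal : exists X : {set S},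
  [/\ X \subset L_class,
      {in L_class, forall a,
         exists2 x, x \in X & exists2 g, g \in H_class & a = x * g}
    & {in X &, forall x y, forall s t, x * s \notin K -> x * s = y * t -> x = y}].
Proof.
(* Representatives of the R-classes, i.e. of the right ideals [a S]. *)
have [X [XL repX injX]] := rep_set (fun a => [set a * s | s : S]) L_class.
exists X; split=> // [a aL | x y xX yX s t xsK xsyt].
  have [x xX xSaS] := repX a aL; exists x => //.
  have [aA aK ae] := L_classP _ aL.
  have [xA xK xe] := L_classP _ (subsetP XL x xX).
  have: a \in [set x * s | s : S] by rewrite xSaS; apply/imsetP; exists e.
  case/imsetP=> w _ aw; have xewe : x * (e * w * e) = a by rewrite !mulA xe -aw.
  exists (e * w * e) => //; apply: mem_H_class.
  by apply: contra aK => ewK; rewrite -xewe; case: (iK x ewK).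
apply: injX => //.
(* By stability, [z] and [z * r] generate the same right ideal as long as the product avoids [K]. *)
have ideal_eq z r : z \in X -> z * r \notin K ->
    [set z * u | u : S] = [set z * r * u | u : S].
  move=> zX zrK; have [zA zK ze] := L_classP _ (subsetP XL z zX).
  have [||u zu] := @right_stable z r; rewrite ?inE ?zK ?zrK ?zA //.
    by case: (iA r zA).
  apply/eqP; rewrite eqEsubset; apply/andP.
  split; apply/subsetP=> _ /imsetP[v _ ->].
    by apply/imsetP; exists (u * v) => //; rewrite {1}zu !mulA.
  by apply/imsetP; exists (r * v) => //; rewrite mulA.
by rewrite (ideal_eq x s) // (ideal_eq y t) // -xsyt.
Qed.

End RegularFactor.

(** * Rees coordinates on a regular factor *)

Section Coordinates.
Variables (S : finType) (mul : SemiGroup.law S) (A K : {set S}).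
Hypothesis RF : regular_factor mul A K.
Local Notation "x * y" := (mul x y).
Local Notation J := (A :\: K).
Let mulA := @SemiGroup.opA S mul.
Let iA : ideal mul A. Proof. by case: RF. Qed.
Let iK : ideal mul K. Proof. by case: RF. Qed.
Variable e : S.
Hypotheses (eJ : e \in J) (ee : e * e = e).
Let eA : e \in A. Proof. by move: eJ; rewrite inE => /andP[]. Qed.
Let eK : e \notin K. Proof. by move: eJ; rewrite inE => /andP[]. Qed.
Let RF' := regular_factor_flip RF.
Local Notation L := (L_class mul A K e).
Local Notation G := (H_class mul A K e).
Local Notation R := (L_class (flip_mul mul) A K e).

Lemma left_inverse_L (a : S) : a \in L -> exists2 u, u \in R & u * a = e.
Proof.
case/L_classP=> aA aK ae.
by have [||u uR ua] := @right_inverse _ _ _ _ RF' e eJ ee a;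
  [rewrite inE aK | | exists u].
Qed.

Lemma H_class_flip : H_class (flip_mul mul) A K e = G.
Proof.
by apply/setP=> x; apply/H_classP/H_classP => -[].
Qed.

(** If [u * x = e], then [e * u * e] is a left inverse of [x] inside the H-class. *)
Lemma H_class_group : exists (gT : finGroupType) (v : gT -> S),
  [/\ injective v, forall x, x \in G <-> exists g, x = v g
    & {morph v : g h / (g * h)%g >-> g * h}].
Proof.
have inv_ex : {in G, forall x, exists2 y, y \in G & y * x = e}.
  move=> x xG; have [xA xK xe ex] := H_classP _ _ _ _ _ xG.
  have [|u _ ux] := @left_inverse_L x.
    by move: xG; rewrite inE => /andP[].
  have uxe : e * u * e * x = e by rewrite -!mulA ex ux ee.
  exists (e * u * e) => //; apply: mem_H_class => //.
  by apply: contra eK => yK; rewrite -uxe; case: (iK x yK).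
apply: (@finGroup_of_set _ _ e) => //; first by apply/H_classP.
  move=> x y xG yG; have [z zG zx] := inv_ex x xG.
  have [xA xK xe ex] := H_classP _ _ _ _ _ xG.
  have [yA yK ye ey] := H_classP _ _ _ _ _ yG.
  apply/H_classP; split.
  - by case: (iA y xA).
  (* With [z * x = e], a product [x * y] in [K] would put [y = z * (x * y)] in [K]. *)
  - by apply: contra yK => xyK; rewrite -ey -zx -mulA; case: (iK z xyK).
  - by rewrite -mulA ye.
  - by rewrite mulA ex.
by move=> x /H_classP[].
Qed.

Lemma rees_coordinates :
  exists (gT : finGroupType) (n m : nat) (P : 'M[option gT]_(m, n))
    (c : gT * 'I_n * 'I_m -> S),
  [/\ injective c, forall x, x \in J <-> exists w, x = c w, regular_mx P
    & forall g i j h k l,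
        if P j k is Some q
        then c (g, i, j) * c (h, k, l) = c ((g * q * h)%g, i, l)
        else c (g, i, j) * c (h, k, l) \in K].
Proof.
have [gT [v [injv Gv vM]]] := H_class_group.
have [X [/subsetP XL genX sepX]] := L_class_transversal RF eJ ee.
have [Y [/subsetP YR genY sepY]] := L_class_transversal RF' eJ ee.
pose a (i : 'I_#|X|) : S := enum_val i.
pose b (j : 'I_#|Y|) : S := enum_val j.
have aL i : a i \in L by apply/XL/enum_valP.
have bR j : b j \in R by apply/YR/enum_valP.
have vG g : v g \in G by apply/Gv; exists g.
have ae i : a i * e = a i by case/L_classP: (aL i).
have eb j : e * b j = b j by case/L_classP: (bR j).
have ve g : v g * e = v g by case/H_classP: (vG g).
have ev g : e * v g = v g by case/H_classP: (vG g).
have b_inv j : exists2 u, u \in L & b j * u = e.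
  by have /L_classP[bA bK _] := bR j; apply: right_inverse; rewrite // inE bK.
have a_inv i : exists2 u, u \in R & u * a i = e by exact: left_inverse_L.
pose c (w : gT * 'I_#|X| * 'I_#|Y|) := let: (g, i, j) := w in a i * v g * b j.
pose P : 'M[option gT]_(#|Y|, #|X|) :=
  (\matrix_(j, i) [pick g | v g == mul (b j) (a i)])%R.
(* [b j * a i] is fixed by [e] on both sides, so outside [K] it belongs to the group. *)
have Pv j i : if P j i is Some q then b j * a i = v q else b j * a i \in K.
  rewrite mxE; case: pickP => [q /eqP // | noq].
  apply/negPn/negP=> baK.
  have /Gv[g gba] : b j * a i \in G.
    have -> : b j * a i = e * (b j * a i) * e by rewrite -!mulA ae mulA eb.
    by apply: mem_H_class => //; rewrite -!mulA ae mulA eb.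
  by move: (noq g); rewrite gba eqxx.
have cJ w : c w \in J.
  case: w => [[g i] j] /=; have [u _ ua] := a_inv i; have [t _ bt] := b_inv j.
  rewrite inE; apply/andP; split; last first.
    have /L_classP[aA _ _] := aL i.
    by rewrite -mulA; case: (iA (v g * b j) aA).
  have /H_classP[_ gK _ _] := vG g.
  (* Cancelling both ends by one-sided inverses recovers [v g], which is not in [K]. *)
  apply: contra gK => xK; have <- : u * (a i * v g * b j) * t = v g.
    by rewrite -!mulA bt ve mulA ua ev.
  by case: (iK u xK) => uxK _; case: (iK t uxK).
exists gT, #|X|, #|Y|, P, c; split.
- move=> [[g i] j] [[h k] l] /= eqc.
  have := cJ (g, i, j); rewrite inE /= => /andP[xK _].
  have ik : i = k.
    apply: enum_val_inj; apply: (sepX _ _ (enum_valP i) (enum_valP k)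
      (v g * b j) (v h * b l)); by rewrite -/(a _) -/(a _) !mulA.
  have jl : j = l.
    apply: enum_val_inj; apply: (sepY _ _ (enum_valP j) (enum_valP l)
      (a i * v g) (a k * v h)); by rewrite /= /flip_mul -/(b _) -/(b _).
  move: eqc; rewrite -ik -jl => eqc.
  have [u _ ua] := a_inv i; have [t _ bt] := b_inv j.
  congr (_, _, _); apply: injv.
  have simp f : u * (a i * v f * b j) * t = v f.
    by rewrite -!mulA bt ve mulA ua ev.
  by rewrite -simp eqc simp.
- move=> x; split=> [xJ | [w ->]]; last exact: cJ.
  (* [x] is the product of [s * e] in the L-class and [e * t] in the R-class; the group parts of the
     two are then multiplied. *)
  have [s [t xst]] : exists s t, x = s * e * t by case: RF => _ _; apply.
  have xK : x \notin K by move: xJ; rewrite inE => /andP[].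
  have seL : s * e \in L.
    apply: mem_L_class => //; apply: contra xK => seK.
    by rewrite xst; case: (iK t seK).
  have etR : e * t \in R.
    apply: (mem_L_class RF' eJ ee); apply: contra xK => etK.
    by rewrite xst -mulA; case: (iK s etK).
  have [y yX [g gG segE]] := genX _ seL.
  have [z zY [h hG ethE]] := genY _ etR.
  rewrite H_class_flip in hG.
  have /Gv[g' gg'] := gG; have /Gv[h' hh'] := hG.
  exists ((g' * h')%g, enum_rank_in yX y, enum_rank_in zY z).
  rewrite /c /a /b !enum_rankK_in // vM -gg' -hh' !mulA -segE -mulA.
  by rewrite -[h * z]ethE mulA -(mulA s) ee.
(* A right inverse of [b j] in the L-class is some [a i] times a group element; [b j * a i] in [K]
   would put [e] in [K]. Columns are dual. *)
- split=> [j | i].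
    have [u uL bu] := b_inv j; have [x xX [g _ uxg]] := genX u uL.
    exists (enum_rank_in xX x); have := Pv j (enum_rank_in xX x).
    case: (P _ _) => //; rewrite /a enum_rankK_in // => bxK.
    by case/negP: eK; rewrite -bu uxg mulA; case: (iK g bxK).
  have [u uR ua] := a_inv i; have [y yY [g _ uyg]] := genY u uR.
  exists (enum_rank_in yY y); have := Pv (enum_rank_in yY y) i.
  case: (P _ _) => //; rewrite /b enum_rankK_in // => yaK.
  by case/negP: eK; rewrite -ua uyg /= /flip_mul -mulA; case: (iK g yaK).
- move=> g i j h k l; have := Pv j k; case: (P j k) => [q|] ba /=.
    by rewrite !vM -ba !mulA.
  rewrite !mulA -(mulA _ (b j)).
  case: (iK (a i * v g) ba) => xK _; case: (iK (v h * b l) xK) => _.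
  by rewrite !mulA.
Qed.

End Coordinates.

(** * Compatibility properties of the congruence [eta_star] *)

Section EtaStar.
Variables (S : Type) (mul : SemiGroup.law S).
Local Notation "x * y" := (mul x y).
Local Notation "x ~ y" := (eta_star mul x y) (at level 70).

Lemma eta_star_refl x : x ~ x.
Proof. by move=> R [[r _ _] _] _; apply: r. Qed.

Lemma eta_star_trans x y t : x ~ y -> y ~ t -> x ~ t.
Proof.
move=> xy yt R cR iR; have [[_ tr _] _] := cR.
by apply: tr (xy R cR iR) (yt R cR iR).
Qed.

Lemma eta_star_mul x y s t : x ~ y -> s ~ t -> x * s ~ y * t.
Proof.
move=> xy st R cR iR; have [[_ tr _] cm] := cR.
apply: tr (y * s) _ _ _; first by case: (cm _ _ s (xy R cR iR)).
by case: (cm _ _ y (st R cR iR)).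
Qed.

Lemma eta_star_sandwich x y s t : x ~ y -> s * x * t ~ s * y * t.
Proof.
move=> xy; apply: eta_star_mul; last exact: eta_star_refl.
by apply: eta_star_mul xy; exact: eta_star_refl.
Qed.

(* As [x * y = y], a word in [e] and [f] equals its last letter, so that [e]
   and [f] are [eta_2]-related already with [z_1 = z_2 = e]. *)
Lemma eta_star_right_zero_band e f :
  e * e = e -> f * f = f -> e * f = f -> f * e = e -> e ~ f.
Proof.
move=> ee ff ef fe R _; apply; apply: Relation_Operators.t_step; exists 2 => //.
exists (fun=> Some e); split=> //.
  by rewrite /lambda /= !(ee, ff, ef, fe).
by rewrite /rho /= !(ee, ff, ef, fe).
Qed.

End EtaStar.

(** * Principal factors: diagonality, descent and the null dichotomy *)

Section PrincipalFactor.
Variables (S : finType) (mul : SemiGroup.law S) (A K : {set S}).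
Local Notation "x * y" := (mul x y).
Local Notation "x ~ y" := (eta_star mul x y) (at level 70).
Local Notation J := (A :\: K).
Let mulA := @SemiGroup.opA S mul.

Lemma regular_factor_isomorphic (gT : finGroupType) (n m : nat)
    (P : 'M[option gT]_(m, n)) (c : gT * 'I_n * 'I_m -> S) :
    injective c -> (forall x, x \in J <-> exists w, x = c w) ->
    (forall g i j h k l,
       if P j k is Some q
       then c (g, i, j) * c (h, k, l) = c ((g * q * h)%g, i, l)
       else c (g, i, j) * c (h, k, l) \in K) ->
  isomorphic (factor A K) (factor_mul mul K)
    (if K == set0 then [set~ None] else [set: rees gT n m]) (rees_mul P).
Proof.
move=> injc cJ cM.
(* [f] inverts [c]; no [Some (c w)] equals [None], so the zero goes to the zero. *)
pose f (u : option S) : rees gT n m := [pick w | Some (c w) == u].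
have fc w : f (Some (c w)) = Some w.
  rewrite /f; case: pickP => [v /eqP[/injc ->] // | /(_ w)].
  by rewrite eqxx.
have fN : f None = None by rewrite /f; case: pickP.
have facP u : u \in factor A K -> u = None /\ K != set0 \/ exists w, u = Some (c w).
  case: u => [x|]; rewrite inE; last by left.
  by move/cJ=> [w ->]; right; exists w.
have cfac w : Some (c w) \in factor A K by rewrite inE; apply/cJ; exists w.
have cK w : (c w \in K) = false.
  by have /cJ : exists v, c w = c v by [exists w]; rewrite inE => /andP[/negbTE].
exists f; split.
- move=> u v /facP[[-> _]|[w ->]] /facP[[-> _]|[w' ->]]; rewrite ?fN ?fc //.
  by case=> ->.
- apply/setP=> w; apply/imsetP/idP => [[u /facP[[-> K0]|[v ->]] ->] | wD].
  + by rewrite fN (negbTE K0).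
  + by rewrite fc; case: ifP; rewrite !inE.
  case: w wD => [w _|]; first by exists (Some (c w)).
  by case: eqP => [_|/eqP K0 _]; rewrite ?inE //; exists None; rewrite ?inE.
- move=> u v /facP[[-> _]|[[[g i] j] ->]] /facP[[-> _]|[[[h k] l] ->]];
    rewrite ?fN ?fc //=.
  have := cM g i j h k l; case: (P j k) => [q ->|->]; last exact: fN.
  by rewrite cK fc.
Qed.

Lemma CS_diagonal_or_descent e : regular_factor mul A K -> e \in J -> e * e = e ->
  CS_diagonal_factor mul A K \/
  exists x y, [/\ x \in J, y \in K & x ~ y].
Proof.
move=> RF eJ ee.
have [gT [n [m [P [c [injc cJ regP cM]]]]]] := rees_coordinates RF eJ ee.
have cE g i j h k l q : P j k = Some q ->
    c (g, i, j) * c (h, k, l) = c ((g * q * h)%g, i, l).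
  by move=> Pq; have := cM g i j h k l; rewrite Pq.
case: (boolP [forall r, forall r', forall t, forall t',
   [&& P r t != None, P r' t != None & P r t' != None] ==> (P r' t' != None)]).
  move=> /'forall_'forall_'forall_'forall_implyP csP; left.
  exists gT, n, m, P; have /cJ[[[g i] j] _] := eJ.
  have iso := regular_factor_isomorphic injc cJ cM.
  split; [exact: leq_ltn_trans (ltn_ord i)
         |exact: leq_ltn_trans (ltn_ord j)| |].
    by move=> r r' t t' Prt Pr't Prt'; apply: (csP r r' t t'); apply/and3P.
  move: iso; case: eqP => [K0 iso|_ iso]; [right | left]; split=> //.
  (* A zero entry would produce a product in [K], which is empty here. *)
  move=> r t; apply/eqP=> Prt; have := cM 1%g t r 1%g t r.
  by rewrite Prt K0 inE.
rewrite negb_forall => /existsP[r]; rewrite negb_forall => /existsP[r'].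
rewrite negb_forall => /existsP[t]; rewrite negb_forall => /existsP[t'].
rewrite negb_imply negbK => /andP[/and3P[]].
case Prt: (P r t) => [q|] // _; case Pr't: (P r' t) => [q'|] // _.
case Prt': (P r t') => [q''|] // _ /eqP Pr't'; right.
(* When [q] is the entry [P r t], the component [q^-1] cancels it and makes this element
   idempotent. *)
pose f r q := c ((q^-1)%g, t, r).
have fE r1 r2 q1 q2 : P r1 t = Some q1 -> f r1 q1 * f r2 q2 = f r2 q2.
  by move=> Pq; rewrite /f (cE _ _ _ _ _ _ q1) // mulVg mul1g.
exists (f r q * c (1%g, t', r)), (f r' q' * c (1%g, t', r)); split.
- by apply/cJ; rewrite /f (cE _ _ _ _ _ _ q'') //; eexists.
- by have := cM (q'^-1)%g t r' 1%g t' r; rewrite Pr't'.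
apply: eta_star_mul; last exact: eta_star_refl.
by apply: eta_star_right_zero_band; apply: fE.
Qed.

Hypotheses (iA : ideal mul A) (iK : ideal mul K) (KA : K \proper A).
Hypothesis minA : ~ exists B, [/\ ideal mul B, K \proper B & B \proper A].

(** The form in which minimality is applied: an ideal strictly above [K] and inside [A] must be
    [A]. *)
Lemma ideal_setU_subset (B : {set S}) :
  B \subset A -> ideal mul (B :|: K) -> {in B, forall b, b \notin K -> A = B :|: K}.
Proof.
move=> BA iBK b bB bK; apply/eqP; rewrite eq_sym eqEproper subUset BA.
rewrite (proper_sub KA) /=; apply/negP=> pBA; apply: minA; exists (B :|: K).
split=> //; rewrite properE subsetUr; apply/subsetPn; exists b => //.
by rewrite inE bB.
Qed.

Lemma principal_factor_cases :
  null_factor mul A K \/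
  regular_factor mul A K /\ exists2 e, e \in J & e * e = e.
Proof.
case: (boolP [exists a in J, exists b in J, a * b \notin K]); last first.
  rewrite negb_exists_in => /forall_inP noprod; left.
  have noprod' a b : a \in J -> b \in J -> a * b \in K.
    move=> aJ bJ; have := noprod a aJ; rewrite negb_exists_in => /forall_inP/(_ b bJ).
    by rewrite negbK.
  have [_ [a aA aK]] := properP KA.
  (* The zero belongs to the factor because [K] contains [a * a], hence is nonempty. *)
  exists None.
    by rewrite inE; apply/set0Pn; exists (a * a); apply: noprod'; rewrite inE aK.
  move=> [x|] [y|] //=; rewrite !inE => /andP[xK xA] /andP[yK yA].
  by rewrite noprod' // inE ?xK ?yK.
case/exists_inP=> a aJ /exists_inP[b bJ abK]; right.
have [aA bA] : a \in A /\ b \in A by move: aJ bJ; rewrite !inE => /andP[_ ->] /andP[_ ->].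
pose B2 := [set mul x y | x in A, y in A].
have A2 : A = B2 :|: K.
  apply: (@ideal_setU_subset _ _ _ (a * b)) => //; last exact: imset2_f.
    by apply/subsetP=> _ /imset2P[x y xA yA ->]; case: (iA y xA).
  move=> z s; rewrite !inE => /orP[/imset2P[x y xA yA ->] | zK]; last first.
    by case: (iK s zK) => -> ->; rewrite !orbT.
  rewrite mulA -(mulA x); split; apply/orP; left; apply: imset2_f => //.
    by case: (iA s xA).
  by case: (iA s yA).
(* If [N] left [K], then [A] would be [N :|: K]; writing [a = u * v] with [v] in [N] or [K] would
   force [a * b] into [K]. *)
pose N := [set x in A | [forall s, forall t, s * x * t \in K]].
have NP x : reflect (x \in A /\ forall s t, s * x * t \in K) (x \in N).
  by rewrite inE; apply: (iffP andP) => -[xA /'forall_forallP].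
have NK x : x \in N -> x \in K.
  move=> xN; apply/negPn/negP=> xK.
  have AN : A = N :|: K.
    apply: (@ideal_setU_subset _ _ _ x) => //; first by apply/subsetP=> y /NP[].
    move=> z s; rewrite !in_setU => /orP[/NP[zA zN] | zK]; last first.
      by case: (iK s zK) => -> ->; rewrite !orbT.
    have [szA zsA] := iA s zA.
    by split; apply/orP; left; apply/NP; split=> // u v; rewrite ?mulA // -mulA.
  move: abK; rewrite {1}A2 in aA; case/setUP: aA => [|aK]; last first.
    by case: (iK b aK) => _ ->.
  case/imset2P=> u v _; rewrite AN => /setUP[/NP[_ vN] | vK] ->.
    by rewrite vN.
  by case: (iK u vK) => uvK _; case: (iK b uvK) => _ ->.
have sim : {in J &, forall x y, exists s t, y = s * x * t}.
  move=> x y; rewrite !inE => /andP[xK xA] /andP[yK yA].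
  pose B := [set mul (mul s x) t | s in S, t in S].
  (* As [x] is not in [N], the ideal S x S together with [K] is strictly larger than [K], hence all
     of [A]. *)
  have [s [t sxtK]] : exists s t, s * x * t \notin K.
    have : x \notin N by apply: contra xK; apply: NK.
    by rewrite inE xA /= => /forallPn[s /forallPn[t ?]]; exists s, t.
  have AB : A = B :|: K.
    apply: (@ideal_setU_subset _ _ _ (s * x * t)) => //; last exact: imset2_f.
      apply/subsetP=> _ /imset2P[u v _ _ ->].
      by case: (iA u xA) => uxA _; case: (iA v uxA).
    move=> z r; rewrite !inE => /orP[/imset2P[u v _ _ ->] | zK]; last first.
      by case: (iK r zK) => -> ->; rewrite !orbT.
    split; apply/orP; left; first by rewrite !mulA; apply: imset2_f.
    by rewrite -mulA; apply: imset2_f.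
  move: yA yK; rewrite AB => /setUP[/imset2P[u v _ _ ->] _ | -> //].
  by exists u, v.
have RF : regular_factor mul A K by split.
split=> //; apply: (regular_factor_idempotent RF aJ bJ).
by rewrite inE abK; case: (iA b aA).
Qed.

End PrincipalFactor.

(** * Descent along the principal series *)

Theorem corollary3p2 (S : finType) (mul : SemiGroup.law S)
    (o : nat) (I : nat -> {set S})
    (p : nat) (hI : principal_series mul o I) (hp : 1 <= p <= o)
    (hnull : ~ null_factor mul (I p) (I p.+1)) :
  [/\ ~ CS_diagonal_factor mul (I p) (I p.+1) ->
        (forall x, x \in I p :\: I p.+1 -> in_eta_star_class_of_zero mul x) \/
        (exists2 q, p < q <= o &
           forall x, x \in I p :\: I p.+1 ->
             exists2 y, y \in I q :\: I q.+1 & eta_star mul x y),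
      (exists2 a, a \in I p :\: I p.+1 & in_eta_star_class_of_zero mul a) ->
        forall x, x \in I p :\: I p.+1 -> in_eta_star_class_of_zero mul x
    & (forall q, p <= q <= o ->
         null_factor mul (I q) (I q.+1) \/ ~ CS_diagonal_factor mul (I q) (I q.+1)) ->
        forall x, x \in I p :\: I p.+1 -> in_eta_star_class_of_zero mul x].
Proof.
have mulA := @SemiGroup.opA S mul.
have [_ Io series] := hI.
have cases q : 1 <= q <= o ->
    null_factor mul (I q) (I q.+1) \/
    regular_factor mul (I q) (I q.+1) /\
      exists2 e, e \in I q :\: I q.+1 & mul e e = e.
  move=> hq; have [iq pq mq] := series q hq.
  apply: principal_factor_cases => // x s xq.
  (* [series] gives ideals up to index [o] only; [I o.+1] is empty, an ideal vacuously. *)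
  have [lt_qo | le_oq] := ltnP q o.
    by have [iq1 _ _] := series q.+1 lt_qo; exact: iq1.
  have [_ le_qo] := andP hq.
  by move: xq; have /eqP-> : q == o; rewrite ?eqn_leq ?le_qo // Io inE.
have ltIo q y : q <= o -> y \in I q.+1 -> q < o.
  by rewrite leq_eqVlt => /predU1P[-> | //]; rewrite Io inE.
have [// | [RFp [e eJ ee]]] := cases p hp.
have [p1 po] := andP hp.
have [_ _ simp] := RFp.
have zero_class :
    (exists2 a, a \in I p :\: I p.+1 & in_eta_star_class_of_zero mul a) ->
    forall x, x \in I p :\: I p.+1 -> in_eta_star_class_of_zero mul x.
  (* Each [x] is a sandwich [s * a * r], and the same sandwich leaves the zero fixed. *)
  move=> [a aJ [t zt at_]] x xJ; exists t => //.
  have [s [r ->]] := simp _ _ aJ xJ.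
  have <- : mul (mul s t) r = t by have [_ ->] := zt s; case: (zt r).
  exact: eta_star_sandwich.
split=> // [nCS | allq].
  right; have [// | [a [y [aJ yK ay]]]] := CS_diagonal_or_descent RFp eJ ee.
  have po1 := ltIo p y po yK.
  (* Among the factors below [p] that some element of [I p :\: I p.+1] reaches,
     the last one is reached by all of them. *)
  pose reached q := forall x, x \in I p :\: I p.+1 ->
    exists2 y, y \in I q :\: I q.+1 & eta_star mul x y.
  have descend d : forall q b z, o - q < d -> p < q <= o ->
      b \in I p :\: I p.+1 -> z \in I q -> eta_star mul b z ->
      exists2 q, p < q <= o & reached q.
    elim: d => [// |d IH] q b z dq /andP[pq qo] bJ zq bz.
    have next c w : c \in I p :\: I p.+1 -> w \in I q.+1 -> eta_star mul c w ->
        exists2 q, p < q <= o & reached q.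
      move=> cJ wq cw; have lt_qo := ltIo q w qo wq.
      apply: (IH q.+1 c w) => //; last by rewrite lt_qo ltnW.
      by rewrite -ltnS (leq_trans _ dq) // ltnS ltn_sub2l.
    (* Either some sandwich keeps [b] in its factor while moving [z] one level down, or every
       sandwich keeping [b] there keeps [z] outside [I q.+1]. The first case cannot recur forever
       since [I o.+1] is empty. *)
    case: (boolP [exists s, exists r, (mul (mul s b) r \in I p :\: I p.+1)
                                   && (mul (mul s z) r \in I q.+1)]).
      move=> /existsP[s /existsP[r /andP[sbrJ szrq]]].
      by apply: next sbrJ szrq _; exact: eta_star_sandwich.
    move=> noexit; exists q; first by rewrite pq.
    move=> x xJ; have [s [r xsbr]] := simp _ _ bJ xJ.
    exists (mul (mul s z) r); last by rewrite xsbr; exact: eta_star_sandwich.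
    have [|iq _ _] := series q; first by rewrite (leq_trans p1 (ltnW pq)).
    rewrite inE; apply/andP; split; last first.
      by case: (iq z s zq) => szq _; case: (iq _ r szq).
    apply: contra noexit => szrq; apply/existsP; exists s; apply/existsP; exists r.
    by rewrite -xsbr xJ.
  by apply: (descend (o - p.+1).+1 p.+1 a y) => //; rewrite ltnSn.
apply: zero_class; exists e => //.
(* While [e] is related to some [z] in [I q], it is also related to an element of [I q.+1], unless a
   null factor exhibits the zero of [S]. *)
have descend d : forall q z, o - q < d -> p <= q <= o -> z \in I q ->
    eta_star mul e z -> in_eta_star_class_of_zero mul e.
  elim: d => [// |d IH] q z dq /andP[pq qo] zq ez.
  have next w : w \in I q.+1 -> eta_star mul e w -> in_eta_star_class_of_zero mul e.
    move=> wq ew; have lt_qo := ltIo q w qo wq.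
    apply: (IH q.+1 w) => //; last by rewrite lt_qo leqW.
    by rewrite -ltnS (leq_trans _ dq) // ltnS ltn_sub2l.
  have [zq1 | zq1] := boolP (z \in I q.+1); first exact: next zq1 ez.
  have zJ : z \in I q :\: I q.+1 by rewrite inE zq1.
  have q1o : 1 <= q <= o by rewrite (leq_trans p1 pq).
  have [iq _ _] := series q q1o.
  have [null | [RFq [f fJ ff] nCS]] : null_factor mul (I q) (I q.+1) \/
      [/\ regular_factor mul (I q) (I q.+1),
          exists2 f, f \in I q :\: I q.+1 & mul f f = f
        & ~ CS_diagonal_factor mul (I q) (I q.+1)].
    have [|[]] := cases q q1o; first by left.
    by have [|nCS RFq idem] := allq q (introT andP (conj pq qo)); [left | right].
  - (* The idempotent [e] is related to [z * z], which lies in [I q.+1] or is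
       the zero of [S]. *)
    have ezz : eta_star mul e (mul z z) by rewrite -ee; exact: eta_star_mul.
    have zF : Some z \in factor (I q) (I q.+1) by rewrite inE.
    case: null => -[t|] tF null; last first.
      by have := null _ _ zF zF => /=; case: ifP => // zzq _; exact: next zzq ezz.
    (* If [None] were in the factor, its square would be [None], not the constant product
       [Some t]. *)
    have q1E : I q.+1 = set0.
      apply/eqP/negPn/negP=> q1N.
      have NF : None \in factor (I q) (I q.+1) by rewrite inE.
      by have := null _ _ NF NF.
    have mulq x y : x \in I q -> y \in I q -> mul x y = t.
      move=> xq yq; have := null (Some x) (Some y).
      by rewrite !inE /= q1E !inE xq yq => /(_ isT isT); case.
    have tq : t \in I q by move: tF; rewrite !inE => /andP[].
    have tt := mulq t t tq tq.
    (* [t * x = t * (t * x)] is a product of two elements of [I q], hence [t]; the other side is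
       symmetric. *)
    exists t; last by rewrite -(mulq z z).
    move=> x; have [xt tx] := iq t x tq; split.
      by rewrite -{1}tt -mulA mulq.
    by rewrite -{1}tt mulA mulq.
  have [// | [x [w [xJ wq xw]]]] := CS_diagonal_or_descent RFq fJ ff.
  have [_ _ simq] := RFq; have [s [r zsxr]] := simq _ _ xJ zJ.
  have [iq1 _ _] := series q.+1 (ltIo q w qo wq).
  apply: (next (mul (mul s w) r)).
    by case: (iq1 w s wq) => swq _; case: (iq1 _ r swq).
  by apply: eta_star_trans ez _; rewrite zsxr; exact: eta_star_sandwich.
apply: (descend (o - p).+1 p e) => //; first by rewrite leqnn.
  by move: eJ; rewrite inE => /andP[].
exact: eta_star_refl.
Qed.
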